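(* Let $(H, G, \alpha, \beta)$ be a matched pair of groups, with $\alpha(g,h)=g\rhd h$ and $\beta(g,h)=g\lhd h$. Let $(\sigma, v, r)$ be a triple where $\sigma \in \mathrm{Aut}(H)$, $v: G \to G$ is a bijective map and $r: G \to H$ is a map such that $v(1_G)=1_G$, $r(1_G)=1_H$ and $$ r \circ v^{-1}\bigl((v(g_{1}) \lhd r(g_{2}))\,v(g_{2})\bigr) = r(g_{1})\bigl(v(g_{1}) \rhd r(g_{2})\bigr) \qquad (\mathrm{A})$$ for all $g_1,g_2\in G$. On the set $G$ define a new multiplication $*$ and two maps $\beta' : G\times H \to G$, $\beta'(g,h)=g\lhd' h$, and $\alpha' : G\times H \to H$, $\alpha'(g,h)=g\rhd' h$, by $$ g_{1} * g_{2} := v^{-1}\bigl((v(g_{1}) \lhd r(g_{2}))\,v(g_{2})\bigr) \qquad (\mathrm{B})$$ $$ g \lhd' h := v^{-1}\bigl(v(g) \lhd \sigma(h)\bigr) \qquad (\mathrm{C})$$ $$ g \rhd' h := \sigma^{-1}(r(g))\;\sigma^{-1}\bigl(v(g) \rhd \sigma(h)\bigr)\;\sigma^{-1}\Bigl(\bigl[r\bigl(v^{-1}(v(g) \lhd \sigma(h))\bigr)\bigr]^{-1}\Bigr) \qquad (\mathrm{D})$$ for all $g_1,g_2,g\in G$ and $h\in H$. Then: (1) $(G,* )$ is a group structure on the set $G$ with $1_G$ as unit. (2) $\bigl(H,(G,* ),\alpha',\beta'\bigr)$ is a matched pair of groups and $$\psi : H\, {}_{\alpha'}\!\bowtie_{\beta'}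 (G,* ) \to H\, {}_{\alpha}\!\bowtie_{\beta} G, \qquad \psi(h,g) := \bigl(\sigma(h)r(g),\, v(g)\bigr)$$ is a $\sigma$-invariant isomorphism of groups. (3) Any $\sigma$-invariant isomorphism arises in this way: for every $\sigma\in\mathrm{Aut}(H)$, every group structure $(G,* )$ on the set $G$ with unit $1_G$, every matched pair $(H,(G,* ),\alpha',\beta')$ and every $\sigma$-invariant isomorphism $\psi: H\, {}_{\alpha'}\!\bowtie_{\beta'} (G,* ) \to H\, {}_{\alpha}\!\bowtie_{\beta} G$, there exist a bijection $v:G\to G$ and a map $r:G\to H$ with $v(1_G)=1_G$, $r(1_G)=1_H$ satisfying (A), such that $*$, $\beta'$, $\alpha'$ are given by (B), (C), (D) and $\psi(h,g)=(\sigma(h)r(g),v(g))$ for all $h\in H$, $g\in G$.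
   Context: A matched pair of groups $(H,G,\alpha,\beta)$ consists of groups $H$, $G$, a left action $\alpha:G\times H\to H$, $\alpha(g,h)=g\rhd h$, of the group $G$ on the set $H$, and a right action $\beta:G\times H\to G$, $\beta(g,h)=g\lhd h$, of the group $H$ on the set $G$, such that for all $g,g_1,g_2\in G$, $h,h_1,h_2\in H$: $g\rhd(h_1h_2)=(g\rhd h_1)\bigl((g\lhd h_1)\rhd h_2\bigr)$ and $(g_1g_2)\lhd h=\bigl(g_1\lhd(g_2\rhd h)\bigr)(g_2\lhd h)$. The bicrossed product $H\,{}_{\alpha}\!\bowtie_{\beta} G$ of a matched pair is the group on the set $H\times G$ with unit $(1_H,1_G)$ and multiplication $(h_1,g_1)(h_2,g_2)=\bigl(h_1(g_1\rhd h_2),\,(g_1\lhd h_2)g_2\bigr)$. The map $i_H(h)=(h,1)$ is an injective group morphism from $H$ into the bicrossed product. Given $\sigma\in\mathrm{Aut}(H)$ and two matched pairs $(H,G',\alpha',\beta')$, $(H,G,\alpha,\beta)$, a $\sigma$-invariant isomorphism is a group isomorphism $\psi:H\,{}_{\alpha'}\!\bowtie_{\beta'}G'\to H\,{}_{\alpha}\!\bowtie_{\beta}G$ with $\psi\circ i_H=i_H\circ\sigma$, i.e. $\psi(h,1)=(\sigma(h),1)$ for all $h\in H$. *)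

(* Defs.v *)
From HB Require Import structures.
From mathcomp Require Import all_boot.

Set Implicit Arguments.
Unset Strict Implicit.
Unset Printing Implicit Defensive.

Local Open Scope group_scope.

Definition mutual_inverse (A B : Type) (f : A -> B) (f' : B -> A) : Prop :=
  cancel f f' /\ cancel f' f.

Definition group_isomorphism (A B : groupType) (f : A -> B) : Prop :=
  {morph f : x y / x * y} /\ bijective f.

Record left_action (G : groupType) (X : Type) (act : G -> X -> X) : Prop := {
  lact1 : forall x, act 1 x = x;
  lactM : forall g1 g2 x, act (g1 * g2) x = act g1 (act g2 x)
}.

Record right_action (H : groupType) (X : Type) (act : X -> H -> X) : Prop := {
  ract1 : forall x, act x 1 = x;
  ractM : forall x h1 h2, act x (h1 * h2) = act (act x h1) h2
}.

Record matched_pair (H G : groupType)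
    (alpha : G -> H -> H) (beta : G -> H -> G) : Prop := {
  mp_left : left_action alpha;
  mp_right : right_action beta;
  mp_alphaM : forall g h1 h2,
    alpha g (h1 * h2) = alpha g h1 * alpha (beta g h1) h2;
  mp_betaM : forall g1 g2 h,
    beta (g1 * g2) h = beta g1 (alpha g2 h) * beta g2 h
}.

(* The carrier is [H * G] under a new name, since [H * G] itself already has
   the direct product as its canonical group structure. *)
Definition bicrossed (H G : groupType) (alpha : G -> H -> H)
    (beta : G -> H -> G) (mp : matched_pair alpha beta) : Type := (H * G)%type.

HB.instance Definition _ (H G : groupType) (alpha : G -> H -> H)
    (beta : G -> H -> G) (mp : matched_pair alpha beta) :=
  Choice.copy (bicrossed mp) (H * G)%type.

Definition bicrossed_mul (H G : groupType) (alpha : G -> H -> H)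
    (beta : G -> H -> G) (mp : matched_pair alpha beta)
    (x y : bicrossed mp) : bicrossed mp :=
  (x.1 * alpha x.2 y.1, beta x.2 y.1 * y.2).

Definition bicrossed_one (H G : groupType) (alpha : G -> H -> H)
    (beta : G -> H -> G) (mp : matched_pair alpha beta) : bicrossed mp :=
  (1, 1).

(* [(h, g) = (h, 1) (1, g)], so the inverse is [(1, g^-1) (h^-1, 1)]. *)
Definition bicrossed_inv (H G : groupType) (alpha : G -> H -> H)
    (beta : G -> H -> G) (mp : matched_pair alpha beta)
    (x : bicrossed mp) : bicrossed mp :=
  (alpha x.2^-1 x.1^-1, beta x.2^-1 x.1^-1).

Lemma alpha_g1 (H G : groupType) (alpha : G -> H -> H) (beta : G -> H -> G)
  (mp : matched_pair alpha beta) g : alpha g 1 = 1.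
Proof.
apply: (mulgI (alpha g 1)); rewrite mulg1.
have := mp_alphaM mp g 1 1; rewrite mulg1 (ract1 (mp_right mp)).
by move=> <-.
Qed.

Lemma beta_1h (H G : groupType) (alpha : G -> H -> H) (beta : G -> H -> G)
  (mp : matched_pair alpha beta) h : beta 1 h = 1.
Proof.
apply: (mulgI (beta 1 h)); rewrite mulg1.
have := mp_betaM mp 1 1 h; rewrite mulg1 (lact1 (mp_left mp)).
by move=> <-.
Qed.

Lemma bicrossed_mulA (H G : groupType) (alpha : G -> H -> H)
    (beta : G -> H -> G) (mp : matched_pair alpha beta) :
  associative (@bicrossed_mul H G alpha beta mp).
Proof.
move=> [h1 g1] [h2 g2] [h3 g3]; rewrite /bicrossed_mul /=; congr pair.
  by rewrite (mp_alphaM mp) (lactM (mp_left mp)) mulgA.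
by rewrite (mp_betaM mp) (ractM (mp_right mp)) mulgA.
Qed.

Lemma bicrossed_mul1 (H G : groupType) (alpha : G -> H -> H)
    (beta : G -> H -> G) (mp : matched_pair alpha beta) :
  left_id (bicrossed_one mp) (@bicrossed_mul H G alpha beta mp).
Proof.
move=> [h g]; rewrite /bicrossed_mul /=.
by rewrite (lact1 (mp_left mp)) (beta_1h mp) !mul1g.
Qed.

Lemma bicrossed_mulr1 (H G : groupType) (alpha : G -> H -> H)
    (beta : G -> H -> G) (mp : matched_pair alpha beta) :
  right_id (bicrossed_one mp) (@bicrossed_mul H G alpha beta mp).
Proof.
move=> [h g]; rewrite /bicrossed_mul /=.
by rewrite (ract1 (mp_right mp)) (alpha_g1 mp) !mulg1.
Qed.

Lemma bicrossed_mulV (H G : groupType) (alpha : G -> H -> H)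
    (beta : G -> H -> G) (mp : matched_pair alpha beta) :
  left_inverse (bicrossed_one mp) (@bicrossed_inv H G alpha beta mp)
    (@bicrossed_mul H G alpha beta mp).
Proof.
move=> [h g]; rewrite /bicrossed_mul /bicrossed_inv /=; congr pair.
  by rewrite -(mp_alphaM mp) mulVg (alpha_g1 mp).
by rewrite -(ractM (mp_right mp)) mulVg (ract1 (mp_right mp)) mulVg.
Qed.

Lemma bicrossed_mulrV (H G : groupType) (alpha : G -> H -> H)
    (beta : G -> H -> G) (mp : matched_pair alpha beta) :
  right_inverse (bicrossed_one mp) (@bicrossed_inv H G alpha beta mp)
    (@bicrossed_mul H G alpha beta mp).
Proof.
move=> [h g]; rewrite /bicrossed_mul /bicrossed_inv /=; congr pair.
  by rewrite -(lactM (mp_left mp)) mulgV (lact1 (mp_left mp)) mulgV.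
by rewrite -(mp_betaM mp) mulgV (beta_1h mp).
Qed.

HB.instance Definition _ (H G : groupType) (alpha : G -> H -> H)
    (beta : G -> H -> G) (mp : matched_pair alpha beta) :=
  isGroup.Build (bicrossed mp) (@bicrossed_mulA H G alpha beta mp)
    (@bicrossed_mul1 H G alpha beta mp) (@bicrossed_mulr1 H G alpha beta mp)
    (@bicrossed_mulV H G alpha beta mp) (@bicrossed_mulrV H G alpha beta mp).

Definition iH (H G : groupType) (alpha : G -> H -> H) (beta : G -> H -> G)
    (mp : matched_pair alpha beta) (h : H) : bicrossed mp := (h, 1).

Record group_structure (T : Type) : Type := GroupStructure {
  gs_mul : T -> T -> T;
  gs_one : T;
  gs_inv : T -> T;
  gs_mulA : associative gs_mul;
  gs_mul1 : left_id gs_one gs_mul;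
  gs_mulr1 : right_id gs_one gs_mul;
  gs_mulV : left_inverse gs_one gs_inv gs_mul;
  gs_mulrV : right_inverse gs_one gs_inv gs_mul
}.

(* The set [T] with [S] as its canonical group structure, even if [T] already
   carries another one. *)
Definition regroup (T : choiceType) (S : group_structure T) : Type := T.

HB.instance Definition _ (T : choiceType) (S : group_structure T) :=
  Choice.copy (regroup S) T.
HB.instance Definition _ (T : choiceType) (S : group_structure T) :=
  isGroup.Build (regroup S) (gs_mulA S) (gs_mul1 S) (gs_mulr1 S)
    (gs_mulV S) (gs_mulrV S).

Definition sigma_invariant_isomorphism (H G' G : groupType)
    (alpha' : G' -> H -> H) (beta' : G' -> H -> G')
    (alpha : G -> H -> H) (beta : G -> H -> G)
    (sigma : H -> H)
    (mp' : matched_pair alpha' beta') (mp : matched_pair alpha beta)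
    (psi : bicrossed mp' -> bicrossed mp) : Prop :=
  group_isomorphism psi /\ forall h, psi (iH mp' h) = iH mp (sigma h).

(* In the definitions below [sigmaV] and [vV] stand for the inverses of [sigma]
   and [v]. *)

Definition vr_compatible (H G : groupType) (alpha : G -> H -> H)
    (beta : G -> H -> G) (v vV : G -> G) (r : G -> H) : Prop :=
  forall g1 g2 : G,
    r (vV (beta (v g1) (r g2) * v g2)) = r g1 * alpha (v g1) (r g2).

Definition star (H G : groupType) (beta : G -> H -> G) (v vV : G -> G)
    (r : G -> H) (g1 g2 : G) : G :=
  vV (beta (v g1) (r g2) * v g2).

Definition deformed_beta (H G : groupType) (beta : G -> H -> G)
    (sigma : H -> H) (v vV : G -> G) (g : G) (h : H) : G :=
  vV (beta (v g) (sigma h)).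

Definition deformed_alpha (H G : groupType) (alpha : G -> H -> H)
    (beta : G -> H -> G) (sigma sigmaV : H -> H) (v vV : G -> G) (r : G -> H)
    (g : G) (h : H) : H :=
  sigmaV (r g) * sigmaV (alpha (v g) (sigma h))
    * sigmaV (r (vV (beta (v g) (sigma h))))^-1.

(* Main.v *)
Require Import Defs.
From HB Require Import structures.
From mathcomp Require Import all_boot.

Set Implicit Arguments.
Unset Strict Implicit.
Unset Printing Implicit Defensive.

Local Open Scope group_scope.

(** The second group enters only through the map [e g = (r g, v g)] into the
    bicrossed product [B] of [mp].  The relation [vr_compatible] says exactly
    that [e] carries [star], written [*] below, to the multiplication of [B].
    The formulas for the deformed actions [alpha'] and [beta'] say exactly that
    [e g (sigma h, 1) = (sigma (alpha' g h), 1) e (beta' g h)].  Since [v] and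
    [sigma] are bijective, every element of [B] can be written in one and only
    one way as [(sigma h, 1) e g], and [psi (h, g)] is that product.

    Everything then follows from the dictionary between matched pairs and exact
    factorizations.  The image of [e] is closed under products, and uniqueness
    of the decomposition makes it closed under inverses ([sectionV]), so [*] is
    a group law, transported from a subgroup of [B].  Comparing the two ways of
    moving the [e]-factors to the right in [e g i h1 i h2] and [e g1 e g2 i h]
    gives the axioms of a matched pair ([factorization_matched_pair]), and
    [psi] is multiplicative for the same reason ([factorization_morph]).

    Conversely, given [psi], the components of [psi (1, g)] are [r g] and [v g].
    Invariance gives [psi (h, g) = (sigma h r g, v g)] since
    [(h, g) = (h, 1) (1, g)]; applying [psi] to [(1, g1) (1, g2)] yields
    [vr_compatible] and the formula for [*], and applying it to [(1, g) (h, 1)]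
    yields the formulas for [alpha'] and [beta']. *)

(** * Exact factorizations and matched pairs *)

(** Each identity of a matched pair is one component of an equality in [B]
    between two products [i h * e g], by uniqueness of that decomposition. *)
Lemma factorization_matched_pair (H G B : groupType) (i : H -> B) (e : G -> B)
    (alpha : G -> H -> H) (beta : G -> H -> G) :
    {morph i : x y / x * y} -> {morph e : x y / x * y} ->
    injective (fun x : H * G => i x.1 * e x.2) ->
    (forall g h, e g * i h = i (alpha g h) * e (beta g h)) ->
  matched_pair alpha beta.
Proof.
move=> iM eM inj swap.
have uniq h g h' g' : i h * e g = i h' * e g' -> h = h' /\ g = g'.
  by move=> E; have [] := inj (h, g) (h', g') E.
have i1 : i 1 = 1 by apply: (mulgI (i 1)); rewrite -iM !mulg1.
have e1 : e 1 = 1 by apply: (mulgI (e 1)); rewrite -eM !mulg1.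
have act1 h : alpha 1 h = h /\ beta 1 h = 1.
  by apply: uniq; rewrite -swap e1 mul1g mulg1.
have actr1 g : alpha g 1 = 1 /\ beta g 1 = g.
  by apply: uniq; rewrite -swap i1 mul1g mulg1.
have actMr g h1 h2 : alpha g (h1 * h2) = alpha g h1 * alpha (beta g h1) h2
    /\ beta g (h1 * h2) = beta (beta g h1) h2.
  by apply: uniq; rewrite -swap !iM mulgA swap -!mulgA swap.
have actMl g1 g2 h : alpha (g1 * g2) h = alpha g1 (alpha g2 h)
    /\ beta (g1 * g2) h = beta g1 (alpha g2 h) * beta g2 h.
  by apply: uniq; rewrite -swap !eM -mulgA swap !mulgA swap.
split; first 1 last.
- by split=> [x | x h1 h2]; [case: (actr1 x) | case: (actMr x h1 h2)].
- by move=> g h1 h2; case: (actMr g h1 h2).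
- by move=> g1 g2 h; case: (actMl g1 g2 h).
- by split=> [x | g1 g2 x]; [case: (act1 x) | case: (actMl g1 g2 x)].
Qed.

Lemma factorization_morph (H G B : groupType) (i : H -> B) (e : G -> B)
    (alpha : G -> H -> H) (beta : G -> H -> G) (mp : matched_pair alpha beta) :
    {morph i : x y / x * y} -> {morph e : x y / x * y} ->
    (forall g h, e g * i h = i (alpha g h) * e (beta g h)) ->
  {morph (fun x : bicrossed mp => i x.1 * e x.2) : x y / x * y}.
Proof.
move=> iM eM swap [h1 g1] [h2 g2].
rewrite [LHS]/= iM eM /= -!mulgA; congr (_ * _).
by rewrite !mulgA swap.
Qed.

(** A law that an injection [e] transports to the multiplication of a group,
    with [1] and inverses in the image of [e], is a group law.  The definition
    is transparent, so its product and unit reduce to [mul] and [one]. *)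
Definition pullback_group_structure (T : Type) (B : groupType) (e : T -> B)
    (mul : T -> T -> T) (one : T) (inv : T -> T) (inj : injective e)
    (eM : {morph e : x y / mul x y >-> x * y}) (e1 : e one = 1)
    (eV : forall x, e (inv x) = (e x)^-1) : group_structure T.
Proof.
refine (@GroupStructure T mul one inv _ _ _ _ _).
- by move=> x y z; apply: inj; rewrite !eM mulgA.
- by move=> x; apply: inj; rewrite eM e1 mul1g.
- by move=> x; apply: inj; rewrite eM e1 mulg1.
- by move=> x; apply: inj; rewrite eM eV e1 mulVg.
- by move=> x; apply: inj; rewrite eM eV e1 mulgV.
Defined.

(** * Deforming a matched pair *)

(** The element [(r g, v g)] of the bicrossed product, the map [e] above; it is
    a section of [x |-> vV x.2]. *)
Definition section (H G : groupType) (alpha : G -> H -> H) (beta : G -> H -> G)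
    (mp : matched_pair alpha beta) (v : G -> G) (r : G -> H) (g : G) :
    bicrossed mp :=
  (r g, v g).

(** The inverse of [g] for [*]: its image under [v] is the second component of
    the inverse of [(r g, v g)] in the bicrossed product. *)
Definition star_inv (H G : groupType) (beta : G -> H -> G) (v vV : G -> G)
    (r : G -> H) (g : G) : G :=
  vV (beta (v g)^-1 (r g)^-1).

Lemma iHM (H G : groupType) (alpha : G -> H -> H) (beta : G -> H -> G)
    (mp : matched_pair alpha beta) : {morph iH mp : x y / x * y}.
Proof.
move=> x y; rewrite /iH; congr pair => /=.
  by rewrite (lact1 (mp_left mp)).
by rewrite (beta_1h mp) mulg1.
Qed.

Lemma iH_mul (H G : groupType) (alpha : G -> H -> H) (beta : G -> H -> G)
    (mp : matched_pair alpha beta) (h : H) (x : bicrossed mp) :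
  iH mp h * x = (h * x.1, x.2).
Proof.
by congr pair; rewrite /= ?(lact1 (mp_left mp)) // (beta_1h mp) mul1g.
Qed.

Lemma mul_iH (H G : groupType) (alpha : G -> H -> H) (beta : G -> H -> G)
    (mp : matched_pair alpha beta) (x : bicrossed mp) (h : H) :
  x * iH mp h = (x.1 * alpha x.2 h, beta x.2 h).
Proof. by congr pair; rewrite /= mulg1. Qed.

Lemma groupisoV (A B : groupType) (f : A -> B) (fV : B -> A) :
    {morph f : x y / x * y} -> mutual_inverse f fV ->
  {morph fV : x y / x * y}.
Proof.
by move=> fM [fK fVK] x y; apply: (can_inj fK); rewrite fM !fVK.
Qed.

Section Deformation.

Variables (H G : groupType) (alpha : G -> H -> H) (beta : G -> H -> G).
Variable mp : matched_pair alpha beta.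
Variables (v vV : G -> G) (r : G -> H).
Hypothesis vK : mutual_inverse v vV.

Let e := section mp v r.

Lemma section_inj : injective e.
Proof. by move=> x y [_ /(can_inj vK.1)]. Qed.

Lemma iH_section_inj h g h' g' :
  iH mp h * e g = iH mp h' * e g' -> h = h' /\ g = g'.
Proof.
rewrite !iH_mul /= => -[Eh /(can_inj vK.1) Eg].
by split=> //; apply: (mulIg (r g)); rewrite Eh Eg.
Qed.

Hypotheses (v1 : v 1 = 1) (r1 : r 1 = 1).
Hypothesis compat : vr_compatible alpha beta v vV r.

Lemma section1 : e 1 = 1.
Proof. by rewrite /e /section v1 r1. Qed.

Lemma sectionM : {morph e : x y / star beta v vV r x y >-> x * y}.
Proof. by move=> x y; rewrite /e /section /star compat vK.2. Qed.

(** The image of [e] is closed under inverses: [(e g)^-1 = (k, 1) e g']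
    for some [k], whence [(k, 1) e (star g' g) = 1], and [k = 1] by uniqueness
    of the decomposition. *)
Lemma sectionV g : e (star_inv beta v vV r g) = (e g)^-1.
Proof.
set g' := star_inv _ _ _ _ _.
pose k := alpha (v g)^-1 (r g)^-1 * (r g')^-1.
have Einv : (e g)^-1 = iH mp k * e g'.
  by rewrite iH_mul /= mulgVK vK.2.
have /iH_section_inj[k1 _] :
    iH mp k * e (star beta v vV r g' g) = iH mp 1 * e 1.
  by rewrite sectionM mulgA -Einv mulVg section1 mulg1.
by rewrite Einv k1 iH_mul mul1g.
Qed.

(** The group with law [star] and unit [1], pulled back along [e]. *)
Definition star_group_structure : group_structure G :=
  pullback_group_structure section_inj sectionM section1 sectionV.

Variables sigma sigmaV : H -> H.
Hypothesis sigmaM : {morph sigma : x y / x * y}.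
Hypothesis sigmaK : mutual_inverse sigma sigmaV.

Let alpha' := deformed_alpha alpha beta sigma sigmaV v vV r.
Let beta' := deformed_beta beta sigma v vV.

Lemma section_swap g h :
  e g * iH mp (sigma h) = iH mp (sigma (alpha' g h)) * e (beta' g h).
Proof.
rewrite mul_iH iH_mul /= /alpha' /beta' /deformed_alpha /deformed_beta vK.2.
by rewrite -!(groupisoV sigmaM sigmaK) sigmaK.2 mulgVK.
Qed.

Lemma deformed_matched_pair :
  @matched_pair H (regroup star_group_structure) alpha' beta'.
Proof.
apply: (@factorization_matched_pair H (regroup star_group_structure) _
  (fun h => iH mp (sigma h)) e).
- by move=> x y; rewrite sigmaM iHM.
- exact: sectionM.
- move=> [h g] [h' g'] /= /iH_section_inj[].
  by move=> /(can_inj sigmaK.1)-> ->.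
- exact: section_swap.
Qed.

Lemma deformed_isomorphism :
  @sigma_invariant_isomorphism H (regroup star_group_structure) G _ _ _ _ sigma
    deformed_matched_pair mp (fun x => (sigma x.1 * r x.2, v x.2)).
Proof.
split; last by move=> h; rewrite /iH /= r1 v1 mulg1.
split.
  move=> x y; have := @factorization_morph H
    (regroup star_group_structure) _ (fun h => iH mp (sigma h)) e
    _ _ deformed_matched_pair _ sectionM section_swap x y.
  by rewrite !iH_mul; apply=> a b; rewrite sigmaM iHM.
(* The inverse solves [sigma h * r g = y.1] and [v g = y.2]. *)
exists (fun y => (sigmaV (y.1 * (r (vV y.2))^-1), vV y.2)).
  by move=> [h g]; rewrite /= vK.1 mulgK sigmaK.1.
by move=> [h g]; rewrite /= vK.2 sigmaK.2 mulgVK.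
Qed.

End Deformation.

(** * Deformations and invariant isomorphisms *)

Theorem theorem2p2 (H G : groupType) (alpha : G -> H -> H) (beta : G -> H -> G)
    (mp : matched_pair alpha beta) :
  (forall (sigma sigmaV : H -> H) (v vV : G -> G) (r : G -> H),
     group_isomorphism sigma -> mutual_inverse sigma sigmaV ->
     mutual_inverse v vV ->
     v 1 = 1 -> r 1 = 1 -> vr_compatible alpha beta v vV r ->
     exists S : group_structure G,
       [/\ forall g1 g2 : G, gs_mul S g1 g2 = star beta v vV r g1 g2,
           gs_one S = 1
         & exists mp' : @matched_pair H (regroup S)
                          (deformed_alpha alpha beta sigma sigmaV v vV r)
                          (deformed_beta beta sigma v vV),
             @sigma_invariant_isomorphism H (regroup S) G _ _ _ _ sigma mp' mp
               (fun x => (sigma x.1 * r x.2, v x.2))])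
  /\
  (forall (sigma sigmaV : H -> H),
     group_isomorphism sigma -> mutual_inverse sigma sigmaV ->
   forall S : group_structure G, gs_one S = 1 ->
   forall (alpha' : G -> H -> H) (beta' : G -> H -> G)
     (mp' : @matched_pair H (regroup S) alpha' beta')
     (psi : bicrossed mp' -> bicrossed mp),
     @sigma_invariant_isomorphism H (regroup S) G _ _ _ _ sigma mp' mp psi ->
   exists (v vV : G -> G) (r : G -> H),
     [/\ mutual_inverse v vV, v 1 = 1, r 1 = 1
       & vr_compatible alpha beta v vV r] /\
     [/\ forall g1 g2 : G, gs_mul S g1 g2 = star beta v vV r g1 g2,
         forall (g : G) (h : H), beta' g h = deformed_beta beta sigma v vV g h,
         forall (g : G) (h : H),
           alpha' g h = deformed_alpha alpha beta sigma sigmaV v vV r g h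
       & forall (h : H) (g : G), psi (h, g) = (sigma h * r g, v g)]).
Proof.
split.
  move=> sigma sigmaV v vV r [sigmaM _] sigmaK vK v1 r1 compat.
  exists (star_group_structure mp vK v1 r1 compat); split=> //.
  exists (deformed_matched_pair mp vK v1 r1 compat sigmaM sigmaK).
  exact: deformed_isomorphism.
move=> sigma sigmaV [sigmaM _] sigmaK S S1 alpha' beta' mp' psi.
move=> [[psiM [phi psiK phiK]] psi_iH].
pose r (g : G) : H := (psi (1, g)).1; pose v (g : G) : G := (psi (1, g)).2.
pose vV (g : G) : G := (phi (1, g)).2.
have psi1 g : psi (1, g) = (r g, v g) by rewrite /r /v; case: (psi _).
have psiE h g : psi (h, g) = (sigma h * r g, v g).
  have -> : (h, g) = iH mp' h * (1, g) :> bicrossed mp'.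
    by rewrite iH_mul mulg1.
  by rewrite psiM psi_iH iH_mul psi1.
have sigma1 : sigma 1 = 1 by apply: (mulgI (sigma 1)); rewrite -sigmaM !mulg1.
(* The unit of [regroup S] is [gs_one S], equal to that of [G] only by [S1]. *)
have psi_one : psi (1, 1 : G) = (1, 1).
  have iH1 : iH mp' 1 = (1, 1 : G) by rewrite -S1.
  by have := psi_iH 1; rewrite iH1 sigma1.
have vK : mutual_inverse v vV.
  split=> g; rewrite /vV.
    (* The preimage of [(1, v g)] has second component [g]. *)
    have <- : psi (sigmaV (r g)^-1, g) = (1, v g).
      by rewrite psiE sigmaK.2 mulVg.
    by rewrite psiK.
  have := phiK (1, g); case: (phi _) => h g'.
  by rewrite psiE => -[].
(* The image of [(1, g1) (1, g2)] under [psi]. *)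
have starE g1 g2 : (r (gs_mul S g1 g2), v (gs_mul S g1 g2))
    = (r g1 * alpha (v g1) (r g2), beta (v g1) (r g2) * v g2).
  have := psiM (1, g1) (1, g2); rewrite (psi1 g1) (psi1 g2).
  apply: etrans; rewrite -psi1; congr (psi (_, _)) => /=.
    by rewrite (alpha_g1 mp') mulg1.
  by rewrite (ract1 (mp_right mp')).
(* The image of [(1, g) (h, 1)] under [psi]. *)
have swapE g h : (sigma (alpha' g h) * r (beta' g h), v (beta' g h))
    = (r g * alpha (v g) (sigma h), beta (v g) (sigma h)).
  rewrite -psiE; have := psiM (1, g) (iH mp' h).
  by rewrite psi_iH !mul_iH psi1 /= mul1g.
have mulE g1 g2 : gs_mul S g1 g2 = star beta v vV r g1 g2.
  by rewrite /star; case: (starE g1 g2) => _ <-; rewrite vK.1.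
have betaE g h : beta' g h = deformed_beta beta sigma v vV g h.
  by rewrite /deformed_beta; case: (swapE g h) => _ <-; rewrite vK.1.
exists v, vV, r; split; split=> //.
- by have := psi1 (1 : G); rewrite psi_one => -[].
- by have := psi1 (1 : G); rewrite psi_one => -[].
- by move=> g1 g2; rewrite -[vV _]mulE; case: (starE g1 g2).
- move=> g h; rewrite /deformed_alpha -[vV _]betaE.
  rewrite -!(groupisoV sigmaM sigmaK); apply: (can_inj sigmaK.1).
  by rewrite sigmaK.2; case: (swapE g h) => <- _; rewrite mulgK.
Qed.
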